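(* Let $\mathcal{H}$ be a real Hilbert space, let $\beta>0$, let $A\colon\mathcal{H}\to 2^{\mathcal{H}}$ and $B\colon\mathcal{H}\to 2^{\mathcal{H}}$ be maximally monotone operators, and let $Q\colon\mathcal{H}\to\mathcal{H}$ be $\beta$-cocoercive. Assume that $\mathcal{X}^\star=\{x\in\mathcal{H} : 0\in Ax+Bx+Qx\}$ is nonempty. Let $\gamma$ be a real number and let $(\tau_n)_{n\geq 1}$ and $(\lambda_n)_{n\geq 1}$ be sequences of strictly positive real numbers. Suppose that there exist $(\tau,\epsilon,\kappa)\in\,]0,1[^3$ and $(\delta,\sigma)\in\,]0,+\infty[^2$ with $$\delta>\frac{\tau^2(1+\tau)+\tau\sigma}{1-\tau^2}$$ such that (i) $\gamma\in\,]0,2\beta\kappa[$; (ii) $\tau\geq\tau_{n+1}\geq\tau_n$ for all $n\geq 1$; (iii) for all $n\geq 1$, $$\epsilon<\lambda_n\leq\frac{\delta-\tau(\tau+\tau^2+\tau\delta+\sigma)}{\alpha\delta(1+\tau+\tau^2+\tau\delta+\sigma)},\qquad\text{where }\alpha=\frac{2\beta}{4\beta-\gamma}.$$ Let $\overline{x}_0=\overline{x}_1\in\mathcal{H}$ and, for $n=1,2,\ldots$, define $$\begin{aligned} w_n&=\overline{x}_n+\tau_n(\overline{x}_n-\overline{x}_{n-1}),\\ x_n&=J_{\gamma B}w_n,\\ y_n&=J_{\gamma A}(2x_n-w_n-\gamma Qx_n),\\ \overline{x}_{n+1}&=w_n+\lambda_n(y_n-x_n).\end{aligned}$$ Then there exists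 a point $w\in\mathcal{H}$ such that the following hold: 1. $\sum_{n\geq 1}\|\overline{x}_{n+1}-\overline{x}_n\|^2<+\infty$. 2. $(\overline{x}_n)_{n\geq 1}$ converges weakly to $w$. 3. $(x_n)_{n\geq 1}$ converges weakly to $x^\star=J_{\gamma B}w$, and $x^\star\in\mathcal{X}^\star$. 4. If at least one of the following holds: (a) $Q$ is demiregular at $x^\star$; (b) $A$ is uniformly monotone at $x^\star$; (c) $B$ is uniformly monotone at $x^\star$; then $(x_n)_{n\geq 1}$ converges strongly to $x^\star$.
   Context: An operator $Q\colon\mathcal{H}\to\mathcal{H}$ is $\beta$-cocoercive if $\langle x-y, Qx-Qy\rangle\geq\beta\|Qx-Qy\|^2$ for all $x,y\in\mathcal{H}$. For a set-valued operator $A\colon\mathcal{H}\to 2^{\mathcal{H}}$, its graph is $\operatorname{gra}A=\{(x,u)\in\mathcal{H}\times\mathcal{H} : u\in Ax\}$, its domain is $\operatorname{dom}A=\{x : Ax\neq\varnothing\}$, and its resolvent is $J_A=(\mathrm{Id}+A)^{-1}$, which is single-valued and defined on all of $\mathcal{H}$ when $A$ is maximally monotone. $A$ is uniformly monotone at $y\in\operatorname{dom}A$ if there exists an increasing (i.e. nondecreasing) function $\phi\colon[0,+\infty[\,\to[0,+\infty]$ vanishing only at $0$ such that $\langle x-y,u-v\rangle\geq\phi(\|x-y\|)$ for all $v\in Ay$ and all $(x,u)\in\operatorname{gra}A$. $A$ is demiregular at $y\in\operatorname{dom}A$ if, for every sequence $(y_n,v_n)_{n}$ in $\operatorname{gra}A$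 and every $v\in Ay$ such that $y_n\rightharpoonup y$ (weakly) and $v_n\to v$ (strongly), one has $y_n\to y$ strongly. A single-valued operator $Q$ is regarded as the set-valued operator $x\mapsto\{Qx\}$. *)

(* Defs.v *)
From mathcomp Require Import all_boot all_order all_algebra.
From mathcomp Require Import all_classical all_reals all_analysis.

Set Implicit Arguments.
Unset Strict Implicit.
Unset Printing Implicit Defensive.

Import Order.TTheory GRing.Theory Num.Theory.
Import numFieldNormedType.Exports.

Local Open Scope classical_set_scope.
Local Open Scope ring_scope.

Section SetValuedOperators.
Context {R : realType} {H : completeNormedModType R}.
Implicit Types (A B : H -> set H) (Q : H -> H).

Definition gra A : set (H * H) := [set p | A p.1 p.2].

Definition dom A : set H := [set x | A x !=set0].

Definition inv_op A : H -> set H := fun u => [set x | A x u].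

Definition add_op A B : H -> set H := fun x => [set u + v | u in A x & v in B x].

Definition scale_op (c : R) A : H -> set H := fun x => [set c *: u | u in A x].

Definition fun_op Q : H -> set H := fun x => [set Q x].

Definition zeros A : set H := [set x | A x 0].

(* J_A = (Id + A)^-1 as a set-valued operator; "p = J_A z" is expressed by
   [resolvent A z = [set p]]. *)
Definition resolvent A : H -> set H := inv_op (add_op (fun_op idfun) A).

End SetValuedOperators.

(* A real Hilbert space is a complete normed module [H] with a positive
   definite symmetric bilinear form [dot] that induces the norm of [H]. *)
Definition induces_norm (R : realType) (H : completeNormedModType R)
    (dot : {dot H for idfun}) : Prop :=
  forall x : H, dot x x = `|x| ^+ 2.

Section HilbertNotions.
Context {R : realType} {H : completeNormedModType R}.
Variable dot : {dot H for idfun}.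
Implicit Types (A : H -> set H) (Q : H -> H).

Definition weak_cvg (u : nat -> H) (l : H) : Prop :=
  forall z : H, (fun n => dot (u n) z) @ \oo --> dot l z.

Definition cocoercive (beta : R) Q : Prop :=
  forall x y : H, beta * `|Q x - Q y| ^+ 2 <= dot (x - y) (Q x - Q y).

Definition monotone A : Prop :=
  forall x u y v : H, gra A (x, u) -> gra A (y, v) -> 0 <= dot (x - y) (u - v).

Definition maximally_monotone A : Prop :=
  monotone A /\
  forall A', monotone A' -> gra A `<=` gra A' -> gra A' = gra A.

(* The modulus [phi] is a function from [0, +oo[ to [0, +oo]; its values at
   negative reals are irrelevant. *)
Definition uniformly_monotone_at A (y : H) : Prop :=
  dom A y /\
  exists phi : R -> \bar R,
    [/\ forall s, 0 <= s -> (0 <= phi s)%E,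
        forall s t, 0 <= s -> s <= t -> (phi s <= phi t)%E,
        forall s, 0 <= s -> (phi s = 0%E <-> s = 0) &
        forall v x u : H, A y v -> gra A (x, u) ->
          (phi `|x - y|%R <= (dot (x - y) (u - v))%R%:E)%E].

Definition demiregular_at A (y : H) : Prop :=
  dom A y /\
  forall (yn vn : nat -> H) (v : H),
    (forall n, gra A (yn n, vn n)) -> A y v ->
    weak_cvg yn y -> vn @ \oo --> v -> yn @ \oo --> y.

End HilbertNotions.

(* Main.v *)
(* Let z = x + gamma b with a in A x, b in B x and a + b + Q x = 0; these are the
   fixed points of the Davis-Yin map w |-> w + (y - x).  Monotonicity of A and B and
   cocoercivity of Q give, after completing a square,
     - <w - z, y - x> >= (1 - gamma / (4 beta)) |y - x|^2 + (nonnegative residuals),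
   so the map is alpha-averaged.  With D_n = |xbar_n - z|^2 and
   V_n = |xbar_n - xbar_(n-1)|^2, the quantity D_n - tau_n D_(n-1) + N V_n with
   N = tau (1 + tau) + tau delta decreases by at least sigma V_(n+1)
   (Bot-Csetnek); hence sum V_n is finite, y_n - x_n -> 0, and D_n converges.
   In particular <w_n - z, y_n - x_n> -> 0, so every residual tends to 0: this yields
   Q x_n -> Q x, and the strong convergence under (a), (b), (c).
   Weak cluster points are taken along ultrafilters (a bounded sequence has a weak
   limit along any ultrafilter by the Riesz representation); they are fixed points
   because the products of two merely weakly convergent sequences cancel in
   <x_n, b_n> + <y_n, a_n>, and the product of two maximally monotone graphs is
   maximal.  Opial's argument identifies all of them. *)
Require Import Defs.
From mathcomp Require Import all_boot all_order all_algebra.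
From mathcomp Require Import all_classical all_reals all_analysis.
From mathcomp Require Import ring lra.

Import Order.TTheory GRing.Theory Num.Theory.
Import numFieldNormedType.Exports.

Local Open Scope classical_set_scope.
Local Open Scope ring_scope.

(** * Inner products, limits along filters, and Riesz representation *)

Section InnerProduct.
Context {R : realType} {H : completeNormedModType R} {dot : {dot H for idfun}}.

Lemma dotC x y : dot x y = dot y x.
Proof. by rewrite (hermC dot x y) /= expr0 mul1r. Qed.

Lemma dotDl x y z : dot (x + y) z = dot x z + dot y z.
Proof. exact: linearDl. Qed.

Lemma dotDr x y z : dot x (y + z) = dot x y + dot x z.
Proof. exact: linearDr. Qed.

Lemma dotNl x y : dot (- x) y = - dot x y.
Proof. exact: linearNl. Qed.

Lemma dotNr x y : dot x (- y) = - dot x y.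
Proof. exact: linearNr. Qed.

Lemma dotZl a x y : dot (a *: x) y = a * dot x y.
Proof. exact: linearZl_LR. Qed.

Lemma dotZr a x y : dot x (a *: y) = a * dot x y.
Proof. by rewrite dotC dotZl dotC. Qed.

Lemma dot0l x : dot 0 x = 0.
Proof. exact: linear0l. Qed.

Definition dotE := (dotDl, dotDr, dotNl, dotNr, dotZl, dotZr).

Hypothesis dot_norm : induces_norm dot.

Lemma dotxx_ge0 x : 0 <= dot x x.
Proof. by rewrite dot_norm sqr_ge0. Qed.

Lemma dot_inj u v : (forall z, dot u z = dot v z) -> u = v.
Proof.
move=> uv; apply/eqP; rewrite -subr_eq0 -normr_eq0 -sqrf_eq0 -dot_norm.
by rewrite dotDl dotNl uv subrr.
Qed.

(** Expand the nonnegative squares of [|y| x + |x| y] and [|y| x - |x| y], then cancel the factor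
    [|x| |y|]. *)
Lemma cauchy_schwarz x y : `|dot x y| <= `|x| * `|y|.
Proof.
have [->|x0] := eqVneq x 0.
  by rewrite dot0l normr0 mulr_ge0.
have [->|y0] := eqVneq y 0.
  by rewrite dotC dot0l normr0 mulr_ge0.
have a0 : 0 < `|x| by rewrite normr_gt0.
have b0 : 0 < `|y| by rewrite normr_gt0.
have ab0 : 0 < `|x| * `|y| by rewrite mulr_gt0.
have := dotxx_ge0 (`|y| *: x + `|x| *: y).
have := dotxx_ge0 (`|y| *: x - `|x| *: y).
rewrite !dotE !dot_norm (dotC y x) => h1 h2.
rewrite ler_norml -(ler_pM2l ab0) -[X in _ && X](ler_pM2l ab0).
apply/andP; split; lra.
Qed.

Lemma cvg_dot0 {T : Type} (F : set_system T) {FF : ProperFilter F} (u v : T -> H) (M : R) :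
  (\forall n \near F, `|u n| <= M) -> v @ F --> 0 ->
  (fun n => dot (u n) (v n)) @ F --> 0.
Proof.
move=> uM v0; apply: norm_cvg0.
have v0' : (fun n => M * `|v n|) @ F --> 0.
  rewrite -[0](mulr0 M) -[X in _ * X](normr0 H).
  by apply: cvgMr; apply: cvg_norm.
apply: (@squeeze_cvgr _ _ _ _ (fun=> 0) (fun n => M * `|v n|)) => //; last exact: cvg_cst.
near=> n; rewrite normr_ge0 /=; apply: (le_trans (cauchy_schwarz _ _)).
by apply: ler_wpM2r => //; near: n.
Unshelve. all: by end_near. Qed.

(** Splitting [v n] as [m + (v n - m)] leaves a weak limit tested on a fixed vector and a bounded
    sequence against a null one. The filter is arbitrary because limits are later taken along
    ultrafilters. *)
Lemma cvg_weak_strong {T : Type} (F : set_system T) {FF : ProperFilter F} (u v : T -> H)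
  (l m : H) (M : R) :
  (\forall n \near F, `|u n| <= M) ->
  (forall z, (fun n => dot (u n) z) @ F --> dot l z) -> v @ F --> m ->
  (fun n => dot (u n) (v n)) @ F --> dot l m.
Proof.
move=> uM ul vm.
have -> : (fun n => dot (u n) (v n)) =
    (fun n => dot (u n) m) \+ (fun n => dot (u n) (v n - m)).
  by apply/funext => n /=; rewrite -dotDr addrC subrK.
rewrite -[dot l m]addr0; apply: cvgD; first exact: ul.
by apply: (@cvg_dot0 _ _ _ _ _ M) => //; apply/subr_cvg0.
Qed.

Lemma cvg_dot {T : Type} (F : set_system T) {FF : ProperFilter F} (u v : T -> H) l m :
  u @ F --> l -> v @ F --> m -> (fun n => dot (u n) (v n)) @ F --> dot l m.
Proof.
move=> ul; apply: (@cvg_weak_strong _ _ _ _ _ _ _ (`|l| + 1)).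
  have lt1 : `|l| < `|l| + 1 by rewrite ltrDl.
  have /cvgr_lt/(_ _ lt1) : (fun n => `|u n|) @ F --> `|l| by exact: cvg_norm.
  by apply: filterS => n /ltW.
move=> z; rewrite dotC; under eq_fun do rewrite dotC.
apply: (@cvg_weak_strong _ _ _ (fun=> z) u z l `|z|) => //.
  exact: nearW.
by move=> y; apply: cvg_cst.
Qed.

Lemma cvg_dot_norm0 {T : Type} (F : set_system T) {FF : ProperFilter F} (u : T -> H) :
  (fun n => dot (u n) (u n)) @ F --> 0 -> u @ F --> 0.
Proof.
move=> u0; apply/cvgrPdist_lt => e e0.
have e20 : 0 < e ^+ 2 by rewrite exprn_gt0.
move/cvgrPdist_lt: u0 => /(_ _ e20).
apply: filterS => n; rewrite !sub0r !normrN dot_norm ger0_norm ?sqr_ge0//.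
by rewrite ltr_pXn2r// ?nnegrE// ltW.
Qed.

Lemma cvgr_ge0 {T : Type} (F : set_system T) {FF : ProperFilter F} (f : T -> R) l :
  f @ F --> l -> (\forall n \near F, 0 <= f n) -> 0 <= l.
Proof.
move=> fl f0; rewrite -(cvg_lim _ fl)//; apply: limr_ge => //.
by apply/cvg_ex; exists l.
Qed.

(** The representing vector minimizes [J x = |x|^2 - 2 l x], which is [|x - p|^2 - |p|^2] when [l]
    is the product with [p]. The first-order condition at the minimizer is the claim. *)
Lemma riesz (l : H -> R) (M : R) :
  (forall a x y, l (a *: x + y) = a * l x + l y) ->
  (forall x, `|l x| <= M * `|x|) ->
  exists p, forall z, l z = dot p z.
Proof.
move=> llin lM.
pose J (x : H) : R := `|x| ^+ 2 - 2 * l x.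
have l0 : l 0 = 0.
  by apply/eqP; rewrite -normr_le0 (le_trans (lM 0))// normr0 mulr0.
have lD x y : l (x + y) = l x + l y by rewrite -[x]scale1r llin mul1r scale1r.
have lZ a x : l (a *: x) = a * l x by rewrite -[a *: x]addr0 llin l0 addr0.
have Jlb x : - M ^+ 2 <= J x.
  have := lM x; rewrite ler_norml /J => /andP[_ h].
  have := sqr_ge0 (`|x| - M); nra.
have hinf : has_inf (range J).
  split; first by exists (J 0), 0.
  by exists (- M ^+ 2) => _ [x _ <-]; exact: Jlb.
pose m := inf (range J).
have mJ x : m <= J x by apply: ge_inf; [case: hinf | exists x].
have Jm k : exists x, J x < m + harmonic k.
  have k0 : 0 < k.+1%:R^-1 :> R by rewrite invr_gt0.
  by have [_ [x _ <-] ?] := inf_adherent k0 hinf; exists x.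
have [u Ju] := choice Jm.
(* Parallelogram law: [|x - y|^2 = 2 J x + 2 J y - 4 J ((x + y) / 2)]. Hence minimizing sequences
   are Cauchy. *)
have par x y : `|x - y| ^+ 2 <= 2 * (J x - m) + 2 * (J y - m).
  have := mJ (2^-1 *: (x + y)).
  rewrite /J lZ lD -!dot_norm !dotE (dotC y x); lra.
have /cauchy_cvgP/cvg_ex[/= p up] : cauchy (u @ \oo).
  apply/cauchyP => e e0.
  have e20 : 0 < e ^+ 2 / 4 by rewrite divr_gt0// exprn_gt0.
  near \oo => k; exists (u k).
  change (\forall n \near \oo, ball (u k) e (u n)); near=> n.
  rewrite -ball_normE /= -(@ltr_pXn2r _ 2)// ?nnegrE// ?(ltW e0)//.
  apply: (le_lt_trans (par _ _)).
  have hk : harmonic k < e ^+ 2 / 4 by near: k; exact: near_infty_natSinv_lt (PosNum e20).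
  have hn : harmonic n < e ^+ 2 / 4 by near: n; exact: near_infty_natSinv_lt (PosNum e20).
  have := Ju k; have := Ju n.
  lra.
exists p => z.
(* With [u n] in place of [p], this quadratic is [J (t z + u n) - J (u n)], which is at least
   [- harmonic n]; the limit in [n] gives the claim. *)
have var t : 0 <= t ^+ 2 * `|z| ^+ 2 + 2 * t * (dot p z - l z).
  have -> : t ^+ 2 * `|z| ^+ 2 + 2 * t * (dot p z - l z) =
      0 + (t ^+ 2 * `|z| ^+ 2 + 2 * t * (dot p z - l z)) by rewrite add0r.
  have : (fun n => harmonic n + (t ^+ 2 * `|z| ^+ 2 + 2 * t * (dot (u n) z - l z))) @ \oo -->
      0 + (t ^+ 2 * `|z| ^+ 2 + 2 * t * (dot p z - l z)).
    apply: cvgD; first exact: cvg_harmonic.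
    apply: cvgD; first exact: cvg_cst.
    apply: cvgMr; apply: cvgB; last exact: cvg_cst.
    by apply: cvg_dot => //; exact: cvg_cst.
  move/cvgr_ge0; apply; apply: nearW => n.
  have := Ju n; have := mJ (t *: z + u n).
  rewrite /J llin -!dot_norm !dotE (dotC z (u n)) ; lra.
(* This [t] makes the quadratic equal to [- t^2 (|z|^2 + 2)], so [t = 0]. The added 1 in the
   denominator covers [z = 0]. *)
have := var ((l z - dot p z) / (`|z| ^+ 2 + 1)).
set d := l z - dot p z; set c := `|z| ^+ 2.
have c0 : 0 <= c by rewrite sqr_ge0.
have c1 : c + 1 != 0 by rewrite gt_eqF// ltr_wpDl.
have -> : dot p z - l z = - d by rewrite /d opprB.
have -> : (d / (c + 1)) ^+ 2 * c + 2 * (d / (c + 1)) * - d =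
    - ((d / (c + 1)) ^+ 2 * (c + 2)) by field.
rewrite oppr_ge0 => h.
have d0 : (d / (c + 1)) ^+ 2 == 0.
  by rewrite eq_le sqr_ge0 andbT; nra.
move: d0; rewrite sqrf_eq0 mulf_eq0 invr_eq0 (negbTE c1) orbF subr_eq0.
by move/eqP.
Unshelve. all: by end_near. Qed.

End InnerProduct.

(** * Limits along ultrafilters *)

Section Ultrafilters.
Context {T : Type}.

(** Compactness of [[-M, M]] provides a cluster point, and a cluster point of an ultrafilter is a
    limit. *)
Lemma ultra_cvg_bounded {R : realType} (F : set_system T) {UF : UltraFilter F}
    (f : T -> R) (M : R) :
  (\forall n \near F, `|f n| <= M) -> exists l : R, f @ F --> l.
Proof.
move=> fM.
have : (f @ F) [set` `[- M, M]].
  by apply: filterS fM => n /=; rewrite in_itv /= ler_norml.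
case/(@segment_compact R (- M) M) => l [_ clusl]; exists l => A Al.
have [//|FA] := in_ultra_setVsetC (f @^-1` A) UF.
by have [n []] := clusl (~` A) A FA Al.
Qed.

(** If the preimage of a neighbourhood is not in [F], then [F] restricted to its complement is
    proper, and an ultrafilter containing it contradicts the hypothesis. *)
Lemma cvg_ultra {U : topologicalType} (F : set_system T) {FF : Filter F}
    (f : T -> U) (l : U) :
  (forall G, UltraFilter G -> F `<=` G -> f @ G --> l) -> f @ F --> l.
Proof.
move=> fl A Al; apply: contrapT => nFA.
have PW : ProperFilter (within (~` (f @^-1` A)) F).
  apply: Build_ProperFilter_ex => B FB; apply: contrapT => nB.
  apply: nFA.
  have {}FB : F [set n | ~ A (f n) -> B n] by exact: FB.
  apply: (@filterS _ F FF _ _ _ FB) => n /= Bn.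
  by apply: contrapT => nAn; apply: nB; exists n; exact: Bn.
have [G [UG FG]] := ultraFilterLemma PW.
have GA : G (f @^-1` A).
  by apply: (fl G UG _ A Al) => B FB; apply: FG; apply: (@filterS _ F FF _ _ _ FB) => n.
have GnA : G (~` (f @^-1` A)) by apply: FG; apply: (@filterE _ F FF).
by have [n []] := filter_ex (filterI GA GnA).
Qed.

End Ultrafilters.

(** The limits of [dot (u n) z] exist for every [z] and form a linear functional of [z] bounded by
    [M]; Riesz represents it by [p]. *)
Lemma ultra_weak_limit {R : realType} {H : completeNormedModType R}
    {dot : {dot H for idfun}} (dot_norm : induces_norm dot)
    {T : Type} (F : set_system T) {UF : UltraFilter F} (u : T -> H) (M : R) :
  (\forall n \near F, `|u n| <= M) ->
  exists p : H, forall z : H, (fun n => dot (u n) z) @ F --> dot p z.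
Proof.
move=> uM.
have bd z : \forall n \near F, `|dot (u n) z| <= M * `|z|.
  move: uM; apply: filterS => n un; apply: (le_trans (cauchy_schwarz dot_norm _ _)).
  exact: ler_wpM2r.
have lim z : exists l : R, (fun n => dot (u n) z) @ F --> l.
  exact: ultra_cvg_bounded (bd z).
have [l ul] := choice lim.
have [||p lp] := @riesz _ _ dot dot_norm l M.
- move=> a x y; rewrite -(cvg_lim (@Rhausdorff R) (ul (a *: x + y))).
  apply: cvg_lim => //.
  under eq_fun do rewrite !dotE.
  by apply: cvgD; [apply: cvgMr|]; exact: ul.
- move=> x.
  have /cvgr_ge0 : (fun n => M * `|x| - `|dot (u n) x|) @ F --> M * `|x| - `|l x|.
    by apply: cvgB; [exact: cvg_cst | apply: cvg_norm; exact: ul].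
  rewrite subr_ge0; apply; move: (bd x); apply: filterS => n; by rewrite subr_ge0.
- by exists p => z; rewrite -lp.
Qed.

(** * Real-number estimates for inertial recursions *)

Section Lyapunov.
Context {R : realType} (D V t : nat -> R) (N sigma tau : R).
Hypothesis D_ge0 : forall n, 0 <= D n.
Hypothesis V_ge0 : forall n, 0 <= V n.
Hypothesis t_bound : forall n, 0 < t n <= tau.
Hypothesis t_nondecr : forall n, t n <= t n.+1.
Hypotheses (N_ge0 : 0 <= N) (sigma_gt0 : 0 < sigma) (tau_lt1 : tau < 1).
Hypothesis step : forall n,
  D n.+2 - (1 + t n) * D n.+1 + t n * D n <= N * V n - (N + sigma) * V n.+1.

(** Energy of the inertial scheme, with [D] a squared distance to a solution and [V] a squared
    increment. It decreases because [t] is nondecreasing: passing from [t n] to [t n.+1] only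
    subtracts more of [D n.+1]. *)
Let G n := D n.+1 - t n * D n + N * V n.

Let G_step n : G n.+1 <= G n - sigma * V n.+1.
Proof.
rewrite /G; have := step n.
have : 0 <= (t n.+1 - t n) * D n.+1 by rewrite mulr_ge0// subr_ge0.
lra.
Qed.

Let G_nonincr : nonincreasing_seq G.
Proof.
apply/nonincreasing_seqP => n; apply: le_trans (G_step n) _.
by rewrite gerBl mulr_ge0// ltW.
Qed.

(** [G n <= C] yields [D n.+1 <= tau * D n + C], and the bound by [M] is preserved by this
    recursion. *)
Let C := D 1 + N * V 0.
Let M := D 0 + C / (1 - tau).

Let C_ge0 : 0 <= C. Proof. by rewrite addr_ge0// mulr_ge0. Qed.

Let G_le n : G n <= C.
Proof.
apply: le_trans (G_nonincr _ _ (leq0n n)) _; rewrite /G /C.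
have : 0 <= t 0 * D 0 by rewrite mulr_ge0//; case/andP: (t_bound 0) => /ltW.
lra.
Qed.

Lemma lyapunov_bounded n : D n <= M.
Proof.
have tau1 : 0 < 1 - tau by rewrite subr_gt0.
have CE : C / (1 - tau) * (1 - tau) = C by rewrite divfK// gt_eqF.
have c0 : 0 <= C / (1 - tau) by rewrite divr_ge0// ltW.
elim: n => [|n IHn]; first by rewrite lerDl.
have := G_le n; rewrite /G.
have h1 : 0 <= N * V n by rewrite mulr_ge0.
have /andP[t0 t1] := t_bound n.
have h2 : t n * D n <= tau * M.
  by apply: ler_pM => //; exact: ltW.
have := D_ge0 0; move: h2 CE; rewrite /M; nra.
Qed.

Let M_ge0 : 0 <= M.
Proof. exact: le_trans (D_ge0 0) (lyapunov_bounded 0). Qed.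

Let G_ge n : - (tau * M) <= G n.
Proof.
have /andP[t0 t1] := t_bound n.
have h2 : t n * D n <= tau * M.
  by apply: ler_pM => //; [exact: ltW | exact: lyapunov_bounded].
have := D_ge0 n.+1; have : 0 <= N * V n by rewrite mulr_ge0.
rewrite /G; lra.
Qed.

(** The decrease [sigma * V n.+1] of [G] telescopes, and [G] stays between [- tau * M] and [C]. *)
Lemma lyapunov_sum n : \sum_(0 <= k < n) V k.+1 <= (C + tau * M) / sigma.
Proof.
rewrite ler_pdivlMr//.
suff : (\sum_(0 <= k < n) V k.+1) * sigma <= G 0 - G n.
  by have := G_ge n; have := G_le 0; lra.
elim: n => [|n IHn]; first by rewrite big_geq// mul0r subrr.
by rewrite big_nat_recr//=; have := G_step n; lra.
Qed.

Let G_cvg : exists g : R, G @ \oo --> g.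
Proof.
apply/cvg_ex; apply: nonincreasing_is_cvgn => //.
by exists (- (tau * M)) => _ [n _ <-]; exact: G_ge.
Qed.

Lemma lyapunov_cvg0 : V @ \oo --> 0.
Proof.
have [g Gg] := G_cvg.
rewrite -cvg_shiftS /=.
have Gg1 : (fun n => G n.+1) @ \oo --> g by rewrite cvg_shiftS.
have dG : (fun n => (G n - G n.+1) / sigma) @ \oo --> 0.
  by rewrite -(mul0r sigma^-1) -(subrr g); apply: cvgMl; apply: cvgB.
apply: (@squeeze_cvgr _ _ _ _ (fun=> 0) (fun n => (G n - G n.+1) / sigma)) => //.
  apply: nearW => n; rewrite V_ge0 /= ler_pdivlMr//.
  by have := G_step n; lra.
exact: cvg_cst.
Qed.

(** Solving the definition of [G] gives [(1 - t n) D n.+1 = G n - t n (D n.+1 - D n) - N V n]. The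
    right side converges, and [t] increases to a limit [s <= tau < 1]. *)
Lemma lyapunov_cvg : (fun n => D n.+1 - D n) @ \oo --> 0 ->
  exists d : R, D @ \oo --> d.
Proof.
move=> dD; have [g Gg] := G_cvg.
have [s ts] : exists s : R, t @ \oo --> s.
  apply/cvg_ex; apply: nondecreasing_is_cvgn.
    by apply/nondecreasing_seqP.
  by exists tau => _ [n _ <-]; case/andP: (t_bound n).
have s1 : 0 < 1 - s.
  rewrite subr_gt0; apply: le_lt_trans tau_lt1.
  rewrite -subr_ge0; apply: (@cvgr_ge0 _ _ \oo _ (fun n => tau - t n)).
    by apply: cvgB => //; exact: cvg_cst.
  by apply: nearW => n; rewrite subr_ge0; case/andP: (t_bound n).
exists ((g - s * 0 - N * 0) / (1 - s)).
rewrite -cvg_shiftS /=.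
have -> : (fun n => D n.+1) =
    (fun n => (G n - t n * (D n.+1 - D n) - N * V n) / (1 - t n)).
  apply/funext => n; have /andP[t0 t1] := t_bound n.
  have : 1 - t n != 0 by rewrite gt_eqF// subr_gt0 (le_lt_trans t1).
  by rewrite /G => h; field.
apply: cvgM; last first.
  by apply: cvgV; [rewrite gt_eqF | apply: cvgB => //; exact: cvg_cst].
apply: cvgB; last by apply: cvgMr; exact: lyapunov_cvg0.
by apply: cvgB => //; exact: cvgM.
Qed.

End Lyapunov.

(* Here [m] stands for [alpha * lambda_n], and [a], [b], [c] for [|v'|^2], [|v|^2],
   [<v', v>], where [v], [v'] are consecutive increments of [xbar]; the mixed term is
   absorbed by the instance [s = t + delta * m] of the quadratic hypothesis. *)
Lemma relaxation_bound {R : realType} (a b c t m tau delta sigma q : R) :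
  0 < t <= tau -> 0 < m -> 0 < delta -> 0 < sigma -> 0 <= a -> 0 <= b ->
  (forall s, 0 <= a - 2 * s * c + s ^+ 2 * b) ->
  m * (delta * (1 + tau + tau ^+ 2 + tau * delta + sigma)) <=
    delta - tau * (tau + tau ^+ 2 + tau * delta + sigma) ->
  m * q = a - 2 * t * c + t ^+ 2 * b ->
  t * (1 + t) * b - (1 - m) * q <=
    (tau * (1 + tau) + tau * delta) * b -
    (tau * (1 + tau) + tau * delta + sigma) * a.
Proof.
move=> /andP[t0 tt] m0 d0 s0 a0 b0 young mb mq.
set K := tau + tau ^+ 2 + tau * delta + sigma in mb.
have tau0 : 0 < tau by lra.
have K0 : 0 < K by rewrite /K; nra.
have mb' : (tau + delta * m) * K <= (1 - m) * delta.
  by move: mb; rewrite /K; lra.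
have m1 : m < 1.
  have : 0 < (tau + delta * m) * K by rewrite mulr_gt0// addr_gt0// mulr_gt0.
  nra.
pose s := t + delta * m.
have sp : 0 < s by rewrite addr_gt0// mulr_gt0.
have hs : s * K <= (1 - m) * delta.
  by apply: le_trans mb'; rewrite ler_pM2r// lerD2r.
(* Adding [t] times the quadratic inequality at [s] removes [c]. Since [s - t = delta * m], what is
   left carries the factor [m], cancelled just after. *)
have hq : m * (delta * a - s * t * delta * b) <= m * (s * q).
  have -> : m * (s * q) = s * (a - 2 * t * c + t ^+ 2 * b) by rewrite -mq; ring.
  have := ler_wpM2l (ltW t0) (young s); rewrite /s; lra.
have {}hq : delta * a - s * t * delta * b <= s * q by rewrite -(ler_pM2l m0).
rewrite -(ler_pM2l sp).
have := ler_wpM2l (ltW (etrans (subr_gt0 _ _) m1)) hq.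
have h1 := ler_wpM2r a0 hs.
(* What remains of the coefficient of [b] after multiplication by [s]; the coefficient of [a] is
   settled by [h1]. *)
have h2 : 0 <= s * b * (tau * (1 + tau) - t * (1 + t) + delta * (tau - t) + m * t * delta).
  rewrite !mulr_ge0 ?(ltW sp)//.
  have : 0 <= m * t * delta by rewrite !mulr_ge0// ltW.
  have : 0 <= delta * (tau - t) by rewrite mulr_ge0 ?subr_ge0// ltW.
  nra.
move: h1 h2; rewrite /K; lra.
Qed.

(** * Inertial Krasnoselskii-Mann iteration of an averaged map *)

Section InertialKM.
Context {R : realType} {H : completeNormedModType R} {dot : {dot H for idfun}}.
Hypothesis dot_norm : induces_norm dot.
Variables (X w e : nat -> H) (t l : nat -> R) (S : set H).
Variables (alpha tau delta sigma eps : R).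
Hypotheses (alpha_gt0 : 0 < alpha) (delta_gt0 : 0 < delta) (sigma_gt0 : 0 < sigma).
Hypotheses (tau_lt1 : tau < 1) (eps_gt0 : 0 < eps).
Hypothesis t_bound : forall n, 0 < t n <= tau.
Hypothesis t_nondecr : forall n, t n <= t n.+1.
Hypothesis l_gt : forall n, eps < l n.
Hypothesis l_le : forall n,
  alpha * l n * (delta * (1 + tau + tau ^+ 2 + tau * delta + sigma)) <=
    delta - tau * (tau + tau ^+ 2 + tau * delta + sigma).
Hypothesis wE : forall n, w n = X n.+1 + t n *: (X n.+1 - X n).
Hypothesis XE : forall n, X n.+2 = w n + l n *: e n.
Hypothesis S_neq0 : S !=set0.
(** Equivalent to [|w + e - z|^2 <= |w - z|^2 - ((1 - alpha) / alpha) |e|^2]: the map [w |-> w + e]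
    is [alpha]-averaged relative to the points of [S]. *)
Hypothesis attracting : forall n z, S z ->
  `|e n| ^+ 2 <= - (2 * alpha * dot (w n - z) (e n)).

Let V n := `|X n.+1 - X n| ^+ 2.
Let N := tau * (1 + tau) + tau * delta.

Let tau_gt0 : 0 < tau.
Proof. by have /andP[t0] := t_bound 0; exact: lt_le_trans. Qed.

Let N_ge0 : 0 <= N.
Proof. by rewrite /N; have := tau_gt0; have := delta_gt0; nra. Qed.

(** With [q = X n.+1 - z] and consecutive increments [v], [v'], the left side equals [2 <q + t v, v'
    - t v> + |v' - t v|^2 + t (1 + t) |v|^2]. The hypothesis [attracting] bounds the product by
    [- |v' - t v|^2 / m], and [relaxation_bound] does the rest. *)
Let km_step z n : S z ->
  `|X n.+2 - z| ^+ 2 - (1 + t n) * `|X n.+1 - z| ^+ 2 + t n * `|X n - z| ^+ 2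
    <= N * V n - (N + sigma) * V n.+1.
Proof.
move=> /(attracting n) att.
have ln : 0 < l n by apply: lt_trans (l_gt n).
pose q := X n.+1 - z; pose v := X n.+1 - X n; pose v' := X n.+2 - X n.+1.
pose m := alpha * l n.
have m0 : 0 < m by rewrite mulr_gt0.
have E2 : X n.+2 - z = q + v' by rewrite /q /v' [RHS]addrC subrKA.
have E0 : X n - z = q - v by rewrite /q /v opprB [RHS]addrC subrKA.
have E1 : X n.+1 - z = q by [].
have Ew : w n - z = q + t n *: v by rewrite wE /q /v addrAC.
have Ee : l n *: e n = v' - t n *: v.
  by rewrite /v' XE wE -/v -(addrA (X n.+1)) (addrC (X n.+1)) addrK [RHS]addrC addKr.
have Ee' : e n = (l n)^-1 *: (v' - t n *: v) by rewrite -Ee scalerA mulVf ?scale1r ?gt_eqF.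
have [EV EV'] : V n = `|v| ^+ 2 /\ V n.+1 = `|v'| ^+ 2 by [].
clearbody q v v'.
have mq : m * (`|v' - t n *: v| ^+ 2 / m) =
    `|v'| ^+ 2 - 2 * t n * dot v' v + t n ^+ 2 * `|v| ^+ 2.
  rewrite mulrC divfK ?gt_eqF// -!dot_norm !dotE (dotC v v'); ring.
have young s : 0 <= `|v'| ^+ 2 - 2 * s * dot v' v + s ^+ 2 * `|v| ^+ 2.
  have := dotxx_ge0 dot_norm (v' - s *: v).
  rewrite -!dot_norm !dotE (dotC v v'); lra.
have := relaxation_bound _ _ _ _ _ _ _ _ _ (t_bound n) m0 delta_gt0 sigma_gt0
  (sqr_ge0 _) (sqr_ge0 _) young (l_le n) mq.
rewrite -/N EV EV'; apply: le_trans.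
have att' : dot (q + t n *: v) (v' - t n *: v) * 2 <= - (`|v' - t n *: v| ^+ 2 / m).
  move: att; rewrite Ew Ee' -!dot_norm dotZl dotZr dotZr.
  set p := dot (v' - _) _; set r := dot (q + _) _ => att.
  rewrite lerNr ler_pdivrMr// /m.
  rewrite -(@ler_pM2l _ ((l n)^-1 ^+ 2)) ?exprn_gt0 ?invr_gt0//.
  move: att; congr (_ <= _); first by rewrite expr2 mulrA.
  by field; rewrite gt_eqF.
rewrite E2 E1 E0 -!dot_norm mulrBl mul1r opprB.
rewrite (mulrC m) divfK ?gt_eqF//.
move: att'; rewrite -!dot_norm.
move: (_ / m) => pm; rewrite !dotE (dotC v v') (dotC v q) (dotC v' q); lra.
Qed.

Let D z n := `|X n - z| ^+ 2.

Let V_ge0 n : 0 <= V n. Proof. exact: sqr_ge0. Qed.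
Let D_ge0 z n : 0 <= D z n. Proof. exact: sqr_ge0. Qed.

Lemma km_sum : exists C, forall n, \sum_(0 <= k < n) V k.+1 <= C.
Proof.
have [z Sz] := S_neq0; eexists => n.
apply: (lyapunov_sum (D z) V t N sigma tau) => // k; exact: km_step.
Qed.

Lemma km_increment_cvg0 : (fun n => X n.+1 - X n) @ \oo --> 0.
Proof.
have [z Sz] := S_neq0; apply: (cvg_dot_norm0 dot_norm).
under eq_fun do rewrite dot_norm.
by apply: (lyapunov_cvg0 (D z) V t N sigma tau) => // k; exact: km_step.
Qed.

Lemma km_bounded : exists M, forall n, `|X n| <= M.
Proof.
have [z Sz] := S_neq0.
have [M DM] : exists M, forall n, D z n <= M.
  eexists => n; apply: (lyapunov_bounded (D z) V t N sigma tau) => // k.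
  exact: km_step.
exists (M + 1 + `|z|) => n; rewrite -[X n](subrK z).
apply: (le_trans (ler_normD _ _)); rewrite lerD2r.
have := DM n; rewrite /D; have := sqr_ge0 (`|X n - z| - 1); nra.
Qed.

(** Successive squared distances differ by [<X n.+1 + X n - 2 z, X n.+1 - X n>], a bounded sequence
    against a null one. *)
Lemma km_dist_cvg z : S z -> exists d : R, D z @ \oo --> d.
Proof.
move=> Sz; apply: (lyapunov_cvg _ V t N sigma tau) => //.
  by move=> k; exact: km_step.
have [M XM] := km_bounded.
have -> : (fun n => D z n.+1 - D z n) =
    (fun n => dot (X n.+1 + X n - 2 *: z) (X n.+1 - X n)).
  apply/funext => n; rewrite /D -!dot_norm !dotE.
  rewrite (dotC z (X n)) (dotC z (X n.+1)) (dotC (X n.+1) (X n)); ring.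
apply: (@cvg_dot0 _ _ _ dot_norm _ _ _ _ _ (M + M + 2 * `|z|)).
  apply: nearW => n; apply: (le_trans (ler_normB _ _)).
  rewrite normrZ ger0_norm// lerD2r.
  by apply: (le_trans (ler_normD _ _)); exact: lerD.
exact: km_increment_cvg0.
Qed.

(** [l n *: e n] is a combination of two consecutive increments, and [l n] stays above [eps]. *)
Lemma km_residual_cvg0 : e @ \oo --> 0.
Proof.
apply: norm_cvg0.
have v0 : (fun n => eps^-1 * (`|X n.+2 - X n.+1| + tau * `|X n.+1 - X n|)) @ \oo --> 0.
  have dX := km_increment_cvg0.
  have dX1 : (fun n => X n.+2 - X n.+1) @ \oo --> 0.
    by move: dX; rewrite -cvg_shiftS.
  rewrite -(mulr0 eps^-1) -[X in _ * X](addr0 0) -[X in _ * (_ + X)](mulr0 tau).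
  rewrite -(normr0 H); apply: cvgMr; apply: cvgD; first exact: cvg_norm.
  by apply: cvgMr; exact: cvg_norm.
apply: (@squeeze_cvgr _ _ _ _ (fun=> 0) _ _ _ _ _ v0); last exact: cvg_cst.
apply: nearW => n; rewrite normr_ge0 /= ler_pdivlMl//.
have ln : 0 < l n by apply: lt_trans (l_gt n).
apply: (@le_trans _ _ (`|l n *: e n|)).
  by rewrite normrZ gtr0_norm// ler_wpM2r// ltW.
have -> : l n *: e n = (X n.+2 - X n.+1) - t n *: (X n.+1 - X n).
  by rewrite XE wE -(addrA (X n.+1)) (addrC (X n.+1)) addrK [RHS]addrC addKr.
apply: (le_trans (ler_normB _ _)); rewrite lerD2l normrZ.
have /andP[t0 tt] := t_bound n.
by rewrite gtr0_norm// ler_wpM2r.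
Qed.

End InertialKM.

Lemma cvg_sub_filter {T : Type} {U : topologicalType} (F G : set_system T)
    (f : T -> U) (l : U) : F `<=` G -> f @ F --> l -> f @ G --> l.
Proof. by move=> FG fl A /fl; exact: FG. Qed.

(** * Monotone operators, resolvents, and the basic splitting inequality *)

Section Operators.
Context {R : realType} {H : completeNormedModType R} {dot : {dot H for idfun}}.
Hypothesis dot_norm : induces_norm dot.
Implicit Types (A B : H -> set H) (Q : H -> H).

Lemma resolvent_scaleP A (c : R) z p :
  resolvent (scale_op c A) z p <-> exists2 u, A p u & z = p + c *: u.
Proof.
split.
  by case=> _ -> [_ [u Au <-]] <-; exists u.
case=> u Au ->; exists p => //; exists (c *: u) => //; by exists u.
Qed.

(** Adjoining [(x, u)] to the graph keeps it monotone, so maximality forces the point to be there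
    already. *)
Lemma maximally_monotone_mem A x u : maximally_monotone dot A ->
  (forall y v, A y v -> 0 <= dot (x - y) (u - v)) -> A x u.
Proof.
move=> [monA maxA] rel.
pose A' : H -> set H := fun y => [set v | A y v \/ y = x /\ v = u].
have monA' : Defs.monotone dot A'.
  move=> p v q w /= [Apv|[/= -> ->]] [Aqw|[/= -> ->]] /=.
  - exact: monA.
  - by have := rel p v Apv; rewrite -(opprB x) -(opprB u) dotNl dotNr opprK.
  - exact: rel.
  - by rewrite subrr dot0l.
have graE : gra A' = gra A by apply: maxA => // -[p v]; left.
by change (gra A (x, u)); rewrite -graE; right.
Qed.

(** Here [p - q = - c (u - v)], so monotonicity gives [|p - q|^2 <= 0]. *)
Lemma resolvent_scale_uniq A (c : R) z p q : Defs.monotone dot A -> 0 < c ->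
  resolvent (scale_op c A) z p -> resolvent (scale_op c A) z q -> p = q.
Proof.
move=> monA c0 /resolvent_scaleP[u Au ->] /resolvent_scaleP[v Av E].
have := monA p u q v Au Av.
have := dotxx_ge0 dot_norm (p - q).
have Euv : p - q = - (c *: (u - v)).
  apply: (dot_inj dot_norm) => y; have := congr1 (dot^~ y) E.
  by rewrite /= !dotE; lra.
rewrite {2}Euv dotNr dotZr => h1 h2.
have {h1 h2} : dot (p - q) (p - q) = 0.
  apply/eqP; rewrite eq_le dotxx_ge0// andbT {2}Euv dotNr dotZr oppr_le0.
  by rewrite mulr_ge0// ltW.
by move/eqP; rewrite dot_norm sqrf_eq0 normr_eq0 subr_eq0 => /eqP.
Qed.

(** Whenever [s n >= e], monotonicity of [phi] gives [phi e <= r n], which fails eventually since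
    [phi e > 0], possibly infinite. *)
Lemma uniform_modulus_cvg0 (phi : R -> \bar R) (s r : nat -> R) :
  (forall s, 0 <= s -> (0 <= phi s)%E) ->
  (forall s t, 0 <= s -> s <= t -> (phi s <= phi t)%E) ->
  (forall s, 0 <= s -> (phi s = 0%E <-> s = 0)) ->
  (forall n, 0 <= s n) -> (forall n, (phi (s n) <= (r n)%:E)%E) ->
  r @ \oo --> 0 -> s @ \oo --> 0.
Proof.
move=> phi_ge0 phi_nd phi_eq0 s_ge0 phi_le r0.
apply/cvgrPdist_lt => e e0.
have phie : (0 < phi e)%E.
  rewrite lt_neqAle phi_ge0 ?ltW// andbT eq_sym; apply/eqP.
  by move/(phi_eq0 _ (ltW e0)) => ee; rewrite ee ltxx in e0.
have : \forall n \near \oo, ((r n)%:E < phi e)%E.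
  case: (phi e) phie => [k|_|//]; last by apply: nearW => n; rewrite ltry.
  rewrite lte_fin => k0; move/cvgr_lt : r0 => /(_ _ k0).
  by apply: filterS => n; rewrite lte_fin.
apply: filterS => n rn; rewrite sub0r normrN ger0_norm// ltNge; apply/negP => en.
have := le_lt_trans (le_trans (phi_nd _ _ (ltW e0) en) (phi_le n)) rn.
by rewrite ltxx.
Qed.

(* The product of two maximally monotone operators is maximally monotone, at a
   diagonal point [(x, x)]. *)
Lemma maximally_monotone_pair A B x a b :
  maximally_monotone dot A -> maximally_monotone dot B ->
  (forall p v q u, B p v -> A q u ->
     0 <= dot (x - p) (b - v) + dot (x - q) (a - u)) ->
  A x a /\ B x b.
Proof.
move=> maxA maxB rel.
have Bxb : B x b.
  apply: (maximally_monotone_mem _ _ _ maxB) => p v Bpv.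
  rewrite leNgt; apply/negP => lt0.
  (* A negative first summand at [(p, v)] makes the second one positive for every [(q, u)]; the
     choice [(q, u) = (x, a)] then gives a contradiction. *)
  have Axa : A x a.
    apply: (maximally_monotone_mem _ _ _ maxA) => q u Aqu.
    by have := rel p v q u Bpv Aqu; lra.
  have := rel p v x a Bpv Axa.
  by rewrite subrr dot0l addr0 leNgt lt0.
split=> //; apply: (maximally_monotone_mem _ _ _ maxA) => q u Aqu.
have := rel x b q u Bxb Aqu.
by rewrite subrr dot0l add0r.
Qed.

(** Once [gamma (a - a0)] is eliminated, right side minus left side is exactly
    [gamma (<x - xs, c> - beta |c|^2)] with [c = Q x - Q xs], nonnegative by cocoercivity. *)
Lemma splitting_residual A B Q (beta gamma : R) x y w b a xs b0 a0 :
  0 < beta -> 0 < gamma -> cocoercive dot beta Q ->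
  w = x + gamma *: b -> 2 *: x - w - gamma *: Q x = y + gamma *: a ->
  a0 + b0 + Q xs = 0 ->
  (1 - gamma / (4 * beta)) * `|y - x| ^+ 2
    + gamma * dot (x - xs) (b - b0) + gamma * dot (y - xs) (a - a0)
    + beta * gamma * `|Q x - Q xs + (2 * beta)^-1 *: (y - x)| ^+ 2
  <= - dot (w - (xs + gamma *: b0)) (y - x).
Proof.
move=> beta0 gamma0 coco wE aE zeroE.
have := coco x xs.
pose p := x - xs; pose q := y - xs; pose b' := b - b0; pose a' := a - a0.
pose c := Q x - Q xs.
have E1 : y - x = q - p by rewrite /q /p opprB addrA subrK.
have E2 : w - (xs + gamma *: b0) = p + gamma *: b'.
  by rewrite wE /p /b' scalerBr opprD addrACA.
have E3 : gamma *: a' = p - q - gamma *: b' - gamma *: c.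
  apply: (dot_inj dot_norm) => z.
  have := congr1 (dot^~ z) aE; have := congr1 (fun v => dot (gamma *: v) z) zeroE.
  rewrite /= wE /p /q /a' /b' /c scaler0 dot0l !dotE; lra.
rewrite -/p -/q -/b' -/a' -/c E1 E2.
clearbody p q b' a' c => {E1 E2 wE aE zeroE}.
have -> : gamma * dot q a' = dot q (gamma *: a') by rewrite dotZr.
rewrite E3 -!dot_norm !dotE (dotC b' q) (dotC q p) (dotC c q) (dotC b' p) (dotC c p) => h.
rewrite -subr_ge0; apply: (@le_trans _ _ (gamma * (dot p c - beta * dot c c))).
  by rewrite mulr_ge0 ?subr_ge0// ltW.
rewrite le_eqVlt; apply/orP; left; apply/eqP; field.
by rewrite gt_eqF.
Qed.

End Operators.

(** * Weak and strong convergence of the splitting sequences *)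

Section SplittingConvergence.
Context {R : realType} {H : completeNormedModType R} {dot : {dot H for idfun}}.
Hypothesis dot_norm : induces_norm dot.
Variables (A B : H -> set H) (Q : H -> H) (beta gamma : R).
Hypotheses (beta_gt0 : 0 < beta) (gamma_gt0 : 0 < gamma) (gamma_lt : gamma < 4 * beta).
Hypotheses (maxA : maximally_monotone dot A) (maxB : maximally_monotone dot B).
Hypothesis cocoQ : cocoercive dot beta Q.

Definition solution xs a0 b0 := [/\ A xs a0, B xs b0 & a0 + b0 + Q xs = 0].

(* The fixed points of the Davis-Yin operator. *)
Definition fixed_points : set H :=
  [set z | exists xs a0 b0, solution xs a0 b0 /\ z = xs + gamma *: b0].

Variables (X w x y a b : nat -> H).
Hypothesis wE : forall n, w n = x n + gamma *: b n.
Hypothesis aE : forall n, 2 *: x n - w n - gamma *: Q (x n) = y n + gamma *: a n.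
Hypotheses (Aya : forall n, A (y n) (a n)) (Bxb : forall n, B (x n) (b n)).

(** Drop the nonnegative residuals in [splitting_residual]; the averaging constant satisfies
    [2 alpha = 1 / (1 - gamma / (4 beta))]. *)
Lemma fixed_points_attracting n z : fixed_points z ->
  `|y n - x n| ^+ 2 <=
    - (2 * (2 * beta / (4 * beta - gamma)) * dot (w n - z) (y n - x n)).
Proof.
move=> [xs [a0 [b0 [[Aa Bb zero0] ->]]]].
have := splitting_residual dot_norm A B Q _ _ _ _ _ _ _ _ _ _
  beta_gt0 gamma_gt0 cocoQ (wE n) (aE n) zero0.
have := maxA.1 _ _ _ _ (Aya n) Aa.
have := maxB.1 _ _ _ _ (Bxb n) Bb.
set r := dot _ (b n - _); set s := dot _ (a n - _).
move=> r0 s0.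
have g0 := ltW gamma_gt0.
have gr0 : 0 <= gamma * r by rewrite mulr_ge0.
have gs0 : 0 <= gamma * s by rewrite mulr_ge0.
set u := beta * gamma * _.
have u0 : 0 <= u by rewrite !mulr_ge0// ?ltW// sqr_ge0.
set d := dot _ (y n - x n) => h.
have d0 : 0 < 4 * beta - gamma by rewrite subr_gt0.
have -> : - (2 * (2 * beta / (4 * beta - gamma)) * d) =
   - d * (4 * beta) / (4 * beta - gamma) by field; rewrite gt_eqF.
rewrite ler_pdivlMr//.
have {}h : (1 - gamma / (4 * beta)) * `|y n - x n| ^+ 2 <= - d by lra.
have b4 : 0 < 4 * beta by rewrite mulr_gt0.
have := ler_wpM2r (ltW b4) h.
have -> : (1 - gamma / (4 * beta)) * `|y n - x n| ^+ 2 * (4 * beta) =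
  `|y n - x n| ^+ 2 * (4 * beta - gamma) by field; rewrite gt_eqF.
by [].
Qed.

Variable M : R.
Hypothesis X_bounded : forall n, `|X n| <= M.
Hypothesis wX : (fun n => w n - X n) @ \oo --> 0.
Hypothesis e0 : (fun n => y n - x n) @ \oo --> 0.
Hypothesis X_dist : forall z, fixed_points z ->
  exists d : R, (fun n => `|X n - z| ^+ 2) @ \oo --> d.

Let squeeze0 (f r : nat -> R) :
  (forall n, 0 <= f n <= r n) -> r @ \oo --> 0 -> f @ \oo --> 0.
Proof.
move=> fr r0; apply: (@squeeze_cvgr _ _ _ _ (fun=> 0) r) => //; last exact: cvg_cst.
exact: nearW.
Qed.

Let w_bounded : \forall n \near \oo, `|w n| <= 1 + M.
Proof.
have /cvgr_lt/(_ _ ltr01) : (fun n => `|w n - X n|) @ \oo --> 0.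
  by rewrite -(normr0 H); exact: cvg_norm.
apply: filterS => n /ltW wn; rewrite -(subrK (X n) (w n)).
by apply: (le_trans (ler_normD _ _)); exact: lerD.
Qed.

(** The resolvent of [gamma B] is nonexpansive: [|x n - xs| <= |w n - z|] with
    [z = xs + gamma b0]. *)
Let x_bounded xs a0 b0 : solution xs a0 b0 ->
  exists K, \forall n \near \oo, `|x n| <= K.
Proof.
move=> [Aa Bb _]; exists (1 + M + `|xs + gamma *: b0| + `|xs|).
move: w_bounded; apply: filterS => n wn.
rewrite -(subrK xs (x n)); apply: (le_trans (ler_normD _ _)); rewrite lerD2r.
apply: (@le_trans _ _ (`|w n - (xs + gamma *: b0)|)); last first.
  by apply: (le_trans (ler_normB _ _)); rewrite lerD2r.
rewrite -(@ler_pXn2r _ 2)// ?nnegrE// -!dot_norm.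
have -> : w n - (xs + gamma *: b0) = (x n - xs) + gamma *: (b n - b0).
  by rewrite wE scalerBr opprD addrACA.
have /= r0 := maxB.1 _ _ _ _ (Bxb n) Bb.
have := dotxx_ge0 dot_norm (gamma *: (b n - b0)).
move: r0; move: (x n - xs) (b n - b0) => p c r0.
have : 0 <= gamma * dot p c by rewrite mulr_ge0// ltW.
by rewrite !dotE (dotC c p); lra.
Qed.

(** The right side [r n] of [splitting_residual] pairs the bounded [w n - z] with the null
    [y n - x n], and it dominates each nonnegative residual. *)
Lemma residuals_cvg0 xs a0 b0 : solution xs a0 b0 ->
  [/\ (fun n => Q (x n)) @ \oo --> Q xs,
      (fun n => dot (x n - xs) (b n - b0)) @ \oo --> 0 &
      (fun n => dot (y n - xs) (a n - a0)) @ \oo --> 0].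
Proof.
move=> [Aa Bb zero0].
pose r n := - dot (w n - (xs + gamma *: b0)) (y n - x n).
have r0 : r @ \oo --> 0.
  rewrite -oppr0; apply: cvgN.
  apply: (@cvg_dot0 _ _ _ dot_norm _ _ _ _ _ (1 + M + `|xs + gamma *: b0|)) => //.
  move: w_bounded; apply: filterS => n wn.
  by apply: (le_trans (ler_normB _ _)); rewrite lerD2r.
have cr0 k : (fun n => k * r n) @ \oo --> 0.
  by rewrite -(mulr0 k); apply: cvgMr.
pose u n := Q (x n) - Q xs + (2 * beta)^-1 *: (y n - x n).
have bounds n : [/\ 0 <= dot (x n - xs) (b n - b0) <= gamma^-1 * r n,
    0 <= dot (y n - xs) (a n - a0) <= gamma^-1 * r n &
    0 <= dot (u n) (u n) <= (beta * gamma)^-1 * r n].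
  have := splitting_residual dot_norm A B Q _ _ _ _ _ _ _ _ _ _
    beta_gt0 gamma_gt0 cocoQ (wE n) (aE n) zero0.
  have /= p1 := maxA.1 _ _ _ _ (Aya n) Aa.
  have /= p2 := maxB.1 _ _ _ _ (Bxb n) Bb.
  have p3 := dotxx_ge0 dot_norm (u n).
  rewrite -/(u n) -/(r n) -!dot_norm.
  have := dotxx_ge0 dot_norm (y n - x n).
  move: p1 p2 p3; move: (dot (y n - xs) _) (dot (x n - xs) _) (dot (u n) _) (dot (y n - x n) _).
  move=> c1 c2 c3 c4 p1 p2 p3 p4 h.
  have h4 : 0 <= (1 - gamma / (4 * beta)) * c4.
    by rewrite mulr_ge0// subr_ge0 ler_pdivrMr ?mul1r ?ltW// mulr_gt0.
  have h1 : 0 <= gamma * c1 by rewrite mulr_ge0// ltW.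
  have h2 : 0 <= gamma * c2 by rewrite mulr_ge0// ltW.
  have h3 : 0 <= beta * gamma * c3 by rewrite !mulr_ge0// ltW.
  rewrite p1 p2 p3 /= !ler_pdivlMl// ?mulr_gt0//.
  by split; lra.
split.
- have u0 : u @ \oo --> 0.
    apply: (cvg_dot_norm0 dot_norm).
    by apply: (squeeze0 _ _ _ (cr0 (beta * gamma)^-1)) => n; case: (bounds n).
  have -> : (fun n => Q (x n)) =
      (fun n => u n - (2 * beta)^-1 *: (y n - x n) + Q xs).
    by apply/funext => n; rewrite /u addrK subrK.
  rewrite -[X in _ --> X]add0r -[X in _ --> X + _]subr0.
  rewrite -[X in _ --> _ - X + _](scaler0 _ (2 * beta)^-1).
  apply: cvgD; last exact: cvg_cst.
  by apply: cvgB => //; apply: cvgZr.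
- by apply: (squeeze0 _ _ _ (cr0 gamma^-1)) => n; case: (bounds n).
- by apply: (squeeze0 _ _ _ (cr0 gamma^-1)) => n; case: (bounds n).
Qed.

Lemma ultra_limit (G : set_system nat) : fixed_points !=set0 ->
  UltraFilter G -> \oo `<=` G ->
  exists q u v, [/\ solution q u v,
    forall z, (fun n => dot (X n) z) @ G --> dot (q + gamma *: v) z &
    forall z, (fun n => dot (x n) z) @ G --> dot q z].
Proof.
move=> [_ [xs [a0 [b0 [sol _]]]]] UG ooG.
have [K /ooG xK] := x_bounded _ _ _ sol.
have [Qx _ _] := residuals_cvg0 _ _ _ sol.
have {}Qx : (fun n => Q (x n)) @ G --> Q xs by exact: cvg_sub_filter Qx.
have eG : (fun n => y n - x n) @ G --> 0 by exact: cvg_sub_filter e0.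
have wXG : (fun n => w n - X n) @ G --> 0 by exact: cvg_sub_filter wX.
have XM : \forall n \near G, `|X n| <= M by exact: nearW.
have [p Xp] := ultra_weak_limit dot_norm G X M XM.
have [q xq] := ultra_weak_limit dot_norm G x K xK.
have dot0r z : dot z 0 = 0 by rewrite dotC dot0l.
have wp z : (fun n => dot (w n) z) @ G --> dot p z.
  have -> : (fun n => dot (w n) z) = (fun n => dot (X n) z + dot (w n - X n) z).
    by apply/funext => n; rewrite -dotDl addrC subrK.
  rewrite -[X in _ --> X]addr0 -(dot0l (dot := dot) z).
  by apply: cvgD => //; apply: cvg_dot => //; exact: cvg_cst.
have ez z : (fun n => dot (y n - x n) z) @ G --> 0.
  by rewrite -(dot0l (dot := dot) z); apply: cvg_dot => //; exact: cvg_cst.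
pose c := Q xs.
(* Forced by [p = q + gamma v] and [u + v + Q q = 0], once [Q q = c] is known. *)
pose v := gamma^-1 *: (p - q); pose u := - (v + c).
have gv : gamma *: v = p - q by rewrite scalerA mulfV ?scale1r ?gt_eqF.
(* As [Q (x n)] converges strongly, cocoercivity at [x n] and [q] passes to the limit and reads
   [0 <= - beta |c - Q q|^2]. *)
have Qq : Q q = c.
  have QxQ : (fun n => Q (x n) - Q q) @ G --> c - Q q.
    by apply: cvgB => //; exact: cvg_cst.
  have /cvgr_ge0 : (fun n => dot (x n) (Q (x n) - Q q) - dot q (Q (x n) - Q q)
      - beta * dot (Q (x n) - Q q) (Q (x n) - Q q)) @ G -->
      dot q (c - Q q) - dot q (c - Q q) - beta * dot (c - Q q) (c - Q q).
    apply: cvgB; last by apply: cvgMr; exact: cvg_dot.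
    apply: cvgB; first exact: (cvg_weak_strong dot_norm _ _ _ _ _ K).
    by apply: cvg_dot => //; exact: cvg_cst.
  rewrite subrr sub0r oppr_ge0 (pmulr_rle0 _ beta_gt0) dot_norm => h.
  apply/esym/eqP; rewrite -subr_eq0 -normr_eq0 -sqrf_eq0 eq_le sqr_ge0 andbT; apply: h.
  apply: nearW => n; have := cocoQ (x n) q.
  by rewrite -dot_norm (dotDl (x n)) dotNl subr_ge0.
have [Aq Bq] : A q u /\ B q v.
  apply: (maximally_monotone_pair A B q u v maxA maxB) => r d s f Brd Asf.
  rewrite -(pmulr_rge0 _ gamma_gt0).
  (* [gamma] times the sum of the two monotonicity products, expanded. The terms [<w n, x n>] and
     [|x n|^2] have cancelled, so each remaining product has a strongly convergent factor. *)
  pose g n := - (gamma * dot (x n) (Q (x n))) - dot (x n) (y n - x n)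
    + (dot (x n) (y n - x n) - dot (w n) (y n - x n)
       - gamma * dot (Q (x n)) (y n - x n) - dot (y n - x n) (y n - x n))
    - gamma * dot (x n) d - (dot (w n) r - dot (x n) r) + gamma * dot r d
    - gamma * (dot (x n) f + dot (y n - x n) f)
    - (dot (x n) s - dot (w n) s - gamma * dot (Q (x n)) s - dot (y n - x n) s)
    + gamma * dot s f.
  pose gl := - (gamma * dot q c) - 0 + (0 - 0 - gamma * dot c 0 - dot (0 : H) 0)
    - gamma * dot q d - (dot p r - dot q r) + gamma * dot r d
    - gamma * (dot q f + 0) - (dot q s - dot p s - gamma * dot c s - 0)
    + gamma * dot s f.
  have -> : gamma * (dot (q - r) (v - d) + dot (q - s) (u - f)) = gl.
    have -> : gamma * (dot (q - r) (v - d) + dot (q - s) (u - f)) =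
      dot (q - r) (gamma *: v - gamma *: d) +
      dot (q - s) (- (gamma *: v) - gamma *: c - gamma *: f).
      by rewrite /u !dotE; ring.
    rewrite /gl gv !dot0r !dotE.
    rewrite (dotC p r) (dotC q r) (dotC q s) (dotC p s) (dotC c s) ; ring.
  have wM := ooG _ w_bounded.
  have we : (fun n => dot (w n) (y n - x n)) @ G --> 0 by exact: (cvg_dot0 dot_norm _ _ _ _ wM).
  have xe : (fun n => dot (x n) (y n - x n)) @ G --> 0 by exact: (cvg_dot0 dot_norm _ _ _ _ xK).
  have xQ : (fun n => dot (x n) (Q (x n))) @ G --> dot q c.
    exact: (cvg_weak_strong dot_norm _ _ _ _ _ K).
  have cst (z : H) : (fun=> z) @ G --> z by exact: cvg_cst.
  have Qs z : (fun n => dot (Q (x n)) z) @ G --> dot c z by exact: cvg_dot.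
  have ggl : g @ G --> gl.
    apply: cvgD; last exact: cvg_cst.
    apply: cvgB; last first.
      apply: cvgB; last exact: ez.
      apply: cvgB; last by apply: cvgMr; exact: Qs.
      by apply: cvgB; [exact: xq | exact: wp].
    apply: cvgB; last by apply: cvgMr; apply: cvgD; [exact: xq | exact: ez].
    apply: cvgD; last exact: cvg_cst.
    apply: cvgB; last by apply: cvgB; [exact: wp | exact: xq].
    apply: cvgB; last by apply: cvgMr; exact: xq.
    apply: cvgD; last first.
      apply: cvgB; last exact: cvg_dot.
      by apply: cvgB; [exact: cvgB | apply: cvgMr; exact: cvg_dot].
    by apply: cvgB => //; apply: cvgN; exact: cvgMr.
  apply: (cvgr_ge0 _ _ _ ggl); apply: nearW => n.
  have /= h1 := maxB.1 _ _ _ _ (Bxb n) Brd.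
  have /= h2 := maxA.1 _ _ _ _ (Aya n) Asf.
  have -> : g n = gamma * dot (x n - r) (b n - d) + gamma * dot (y n - s) (a n - f).
    have <- : dot (x n - r) (gamma *: (b n - d)) = gamma * dot (x n - r) (b n - d).
      exact: dotZr.
    have <- : dot (y n - s) (gamma *: (a n - f)) = gamma * dot (y n - s) (a n - f).
      exact: dotZr.
    have gb : gamma *: (b n - d) = w n - x n - gamma *: d.
      by rewrite wE scalerBr (addrC (x n)) addrK.
    have ga : gamma *: (a n - f) =
        x n - w n - gamma *: Q (x n) - (y n - x n) - gamma *: f.
      apply: (dot_inj dot_norm) => z; have := congr1 (dot^~ z) (aE n).
      by rewrite /= !dotE; lra.
    have yE : y n - s = x n + (y n - x n) - s by rewrite addrC (addrC (x n)) subrK addrC.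
    rewrite gb ga yE /g.
    move: (x n) (w n) (Q (x n)) (y n - x n) => k4 k2 k3 k1.
    rewrite !dotE (dotC k1 k4) (dotC k1 k2) (dotC k1 k3).
    rewrite (dotC k4 r) (dotC k2 r) (dotC k4 s) (dotC k2 s) (dotC k3 s) (dotC k1 s).
    ring.
  by apply: addr_ge0; apply: mulr_ge0 => //; exact: ltW.
exists q, u, v; split=> //.
  by split=> //; rewrite Qq -addrA addNr.
by move=> z; rewrite gv addrC subrK.
Qed.

(** Opial's argument: [2 <X n, z1 - z2>] differs from [|X n - z2|^2 - |X n - z1|^2] by a constant,
    so it converges, and both filters see the same limit. *)
Lemma weak_limit_uniq (G1 G2 : set_system nat) z1 z2 :
  ProperFilter G1 -> ProperFilter G2 -> \oo `<=` G1 -> \oo `<=` G2 ->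
  fixed_points z1 -> fixed_points z2 ->
  (forall z, (fun n => dot (X n) z) @ G1 --> dot z1 z) ->
  (forall z, (fun n => dot (X n) z) @ G2 --> dot z2 z) -> z1 = z2.
Proof.
move=> PG1 PG2 oG1 oG2 /X_dist[d1 Xd1] /X_dist[d2 Xd2] Xz1 Xz2.
have [k Xk] : exists k : R, (fun n => dot (X n) (z1 - z2)) @ \oo --> k.
  exists ((d2 - d1 - (`|z2| ^+ 2 - `|z1| ^+ 2)) / 2).
  have -> : (fun n => dot (X n) (z1 - z2)) =
    (fun n => (`|X n - z2| ^+ 2 - `|X n - z1| ^+ 2 - (`|z2| ^+ 2 - `|z1| ^+ 2)) / 2).
    apply/funext => n; rewrite -!dot_norm !dotE (dotC z1 (X n)) (dotC z2 (X n)).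
    by field.
  by apply: cvgMl; apply: cvgB; [exact: cvgB | exact: cvg_cst].
have k1 : dot z1 (z1 - z2) = k.
  by rewrite -(cvg_lim (@Rhausdorff R) (Xz1 _)); apply: cvg_lim => //; exact: cvg_sub_filter Xk.
have k2 : dot z2 (z1 - z2) = k.
  by rewrite -(cvg_lim (@Rhausdorff R) (Xz2 _)); apply: cvg_lim => //; exact: cvg_sub_filter Xk.
apply/eqP; rewrite -subr_eq0 -normr_eq0 -sqrf_eq0 -dot_norm dotDl dotNl k1 k2.
by rewrite subrr.
Qed.

(** All ultrafilters finer than [\oo] yield the same fixed point, hence the same [q] by uniqueness
    of the resolvent of [B]; [cvg_ultra] concludes. *)
Lemma splitting_weak_cvg : fixed_points !=set0 -> exists q u v,
  [/\ solution q u v, weak_cvg dot X (q + gamma *: v) & weak_cvg dot x q].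
Proof.
move=> S0.
have [G [UG oG]] := ultraFilterLemma eventually_filter.
have [q [u [v [sol Xq xq]]]] := ultra_limit G S0 UG oG.
have lim G' : UltraFilter G' -> \oo `<=` G' ->
    (forall z, (fun n => dot (X n) z) @ G' --> dot (q + gamma *: v) z) /\
    (forall z, (fun n => dot (x n) z) @ G' --> dot q z).
  move=> UG' oG'.
  have [q' [u' [v' [sol' Xq' xq']]]] := ultra_limit G' S0 UG' oG'.
  have Eq : q + gamma *: v = q' + gamma *: v'.
    apply: (weak_limit_uniq G G') => //; first by exists q, u, v.
    by exists q', u', v'.
  have qq' : q = q'.
    apply: (resolvent_scale_uniq dot_norm B gamma (q + gamma *: v) _ _ maxB.1) => //.
      by apply/resolvent_scaleP; exists v => //; case: sol.
    by rewrite Eq; apply/resolvent_scaleP; exists v' => //; case: sol'.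
  by rewrite {2}qq' Eq.
by exists q, u, v; split=> // z; apply: cvg_ultra => G' UG' oG';
  have [] := lim G' UG' oG'.
Qed.

Lemma splitting_strong_cvg q u v : solution q u v -> weak_cvg dot x q ->
  [\/ demiregular_at dot (fun_op Q) q, uniformly_monotone_at dot A q |
      uniformly_monotone_at dot B q] -> x @ \oo --> q.
Proof.
move=> sol xq; have [Qx rB rA] := residuals_cvg0 _ _ _ sol.
have norm_cvg (s : nat -> H) : (fun n => `|s n - q|) @ \oo --> 0 -> s @ \oo --> q.
  by move=> s0; apply/subr_cvg0; exact: norm_cvg0.
have [Aq Bq _] := sol.
case=> [[_ demi]|[_ [phi [p1 p2 p3 mono]]]|[_ [phi [p1 p2 p3 mono]]]].
- by apply: (demi x (Q \o x) (Q q)).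
- have yq : y @ \oo --> q.
    apply: norm_cvg; apply: (uniform_modulus_cvg0 phi _ _ p1 p2 p3 _ _ rA) => n //.
    exact: mono (Aya n).
  (* Under uniform monotonicity of [A] it is [y] that converges first; [x] follows through
     [y n - x n]. *)
  have -> : x = (fun n => y n - (y n - x n)).
    by apply/funext => n; rewrite opprB addrC subrK.
  by rewrite -(subr0 q); apply: cvgB.
- apply: norm_cvg; apply: (uniform_modulus_cvg0 phi _ _ p1 p2 p3 _ _ rB) => n //.
  exact: mono (Bxb n).
Qed.

End SplittingConvergence.

(** * Convergence of the inertial Davis-Yin scheme *)

Theorem theorem1 (R : realType) (H : completeNormedModType R)
  (dot : {dot H for idfun}) (dot_norm : induces_norm dot)
  (beta : R) (beta_gt0 : 0 < beta)
  (A B : H -> set H) (Q : H -> H)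
  (maxA : maximally_monotone dot A) (maxB : maximally_monotone dot B)
  (cocoQ : cocoercive dot beta Q)
  (solvable : zeros (add_op (add_op A B) (fun_op Q)) !=set0)
  (gamma : R) (tau_ lambda_ : nat -> R)
  (tau_gt0 : forall n, (1 <= n)%N -> 0 < tau_ n)
  (lambda_gt0 : forall n, (1 <= n)%N -> 0 < lambda_ n)
  (tau eps kappa delta sigma : R)
  (tau01 : 0 < tau < 1) (eps01 : 0 < eps < 1) (kappa01 : 0 < kappa < 1)
  (delta_gt0 : 0 < delta) (sigma_gt0 : 0 < sigma)
  (delta_bound :
    (tau ^+ 2 * (1 + tau) + tau * sigma) / (1 - tau ^+ 2) < delta)
  (gamma_bound : 0 < gamma < 2 * beta * kappa)
  (tau_bound : forall n, (1 <= n)%N -> tau_ n <= tau_ n.+1 <= tau)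
  (lambda_bound :
    let alpha := 2 * beta / (4 * beta - gamma) in
    forall n, (1 <= n)%N ->
      eps < lambda_ n <=
        (delta - tau * (tau + tau ^+ 2 + tau * delta + sigma)) /
        (alpha * delta * (1 + tau + tau ^+ 2 + tau * delta + sigma)))
  (xbar w x y : nat -> H)
  (xbar01 : xbar 0%N = xbar 1%N)
  (wE : forall n, (1 <= n)%N ->
    w n = xbar n + tau_ n *: (xbar n - xbar n.-1))
  (xE : forall n, (1 <= n)%N ->
    resolvent (scale_op gamma B) (w n) = [set x n])
  (yE : forall n, (1 <= n)%N ->
    resolvent (scale_op gamma A) (2 *: x n - w n - gamma *: Q (x n)) = [set y n])
  (xbarE : forall n, (1 <= n)%N ->
    xbar n.+1 = w n + lambda_ n *: (y n - x n)) :
  exists wstar xstar : H,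
    [/\ (\sum_(1 <= n <oo) (`|xbar n.+1 - xbar n| ^+ 2)%R%:E < +oo)%E,
        weak_cvg dot xbar wstar,
        [/\ resolvent (scale_op gamma B) wstar = [set xstar],
            weak_cvg dot x xstar &
            zeros (add_op (add_op A B) (fun_op Q)) xstar] &
        [\/ demiregular_at dot (fun_op Q) xstar,
            uniformly_monotone_at dot A xstar |
            uniformly_monotone_at dot B xstar] ->
          x @ \oo --> xstar].
Proof.
have [tau0 tau1] := andP tau01; have [eps0 _] := andP eps01.
have [kappa0 kappa1] := andP kappa01; have [gamma0 gammab] := andP gamma_bound.
have gamma4 : gamma < 4 * beta.
  have : beta * kappa <= beta by rewrite ger_pMr// ltW.
  lra.
have alpha0 : 0 < 2 * beta / (4 * beta - gamma).
  by rewrite divr_gt0 ?subr_gt0// mulr_gt0.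
have bP n : exists b, B (x n.+1) b /\ w n.+1 = x n.+1 + gamma *: b.
  have : resolvent (scale_op gamma B) (w n.+1) (x n.+1) by rewrite xE.
  by case/resolvent_scaleP => b; exists b.
have aP n : exists a, A (y n.+1) a /\
    2 *: x n.+1 - w n.+1 - gamma *: Q (x n.+1) = y n.+1 + gamma *: a.
  have : resolvent (scale_op gamma A)
    (2 *: x n.+1 - w n.+1 - gamma *: Q (x n.+1)) (y n.+1) by rewrite yE.
  by case/resolvent_scaleP => a; exists a.
have [b bE] := choice bP; have [a aE] := choice aP.
pose Z := fixed_points A B Q gamma.
have Z0 : Z !=set0.
  case: solvable => xs [_ [a0 Aa [b0 Bb <-]] [_ -> zero0]].
  by exists (xs + gamma *: b0), xs, a0, b0.
(* Only indices from 1 on are constrained for [w], [x], [y], so these are shifted by one while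
   [xbar] keeps its index 0. *)
pose x1 n := x n.+1; pose y1 n := y n.+1; pose w1 n := w n.+1.
have w1E n : w1 n = x1 n + gamma *: b n by case: (bE n).
have a1E n : 2 *: x1 n - w1 n - gamma *: Q (x1 n) = y1 n + gamma *: a n.
  by case: (aE n).
have Aya n : A (y1 n) (a n) by case: (aE n).
have Bxb n : B (x1 n) (b n) by case: (bE n).
have att n z (Zz : Z z) := fixed_points_attracting dot_norm A B Q beta gamma
  beta_gt0 gamma0 gamma4 maxA maxB cocoQ w1 x1 y1 a b w1E a1E Aya Bxb n z Zz.
have t_bound n : 0 < tau_ n.+1 <= tau.
  rewrite tau_gt0//=; have /andP[h1 h2] := tau_bound n.+1 isT.
  exact: le_trans h2.
have t_nondecr n : tau_ n.+1 <= tau_ n.+2 by have /andP[] := tau_bound n.+1 isT.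
have l_gt n : eps < lambda_ n.+1 by have /andP[] := lambda_bound n.+1 isT.
have l_le n : 2 * beta / (4 * beta - gamma) * lambda_ n.+1 *
    (delta * (1 + tau + tau ^+ 2 + tau * delta + sigma)) <=
    delta - tau * (tau + tau ^+ 2 + tau * delta + sigma).
  have /andP[_] := lambda_bound n.+1 isT.
  rewrite ler_pdivlMr; last first.
    have := mulr_gt0 tau0 delta_gt0; have := sqr_ge0 tau => h1 h2.
    by apply: mulr_gt0; [exact: mulr_gt0 | lra].
  by apply: le_trans; rewrite le_eqVlt; apply/orP; left; apply/eqP; ring.
have wXE n : w1 n = xbar n.+1 + tau_ n.+1 *: (xbar n.+1 - xbar n) by exact: wE.
have XE n : xbar n.+2 = w1 n + lambda_ n.+1 *: (y1 n - x1 n) by exact: xbarE.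
have [C sumC] := km_sum dot_norm xbar w1 _ _ _ Z _ tau delta sigma eps
  alpha0 delta_gt0 sigma_gt0 tau1 eps0 t_bound t_nondecr l_gt l_le wXE XE Z0 att.
have incr0 := km_increment_cvg0 dot_norm xbar w1 _ _ _ Z _ tau delta sigma eps
  alpha0 delta_gt0 sigma_gt0 tau1 eps0 t_bound t_nondecr l_gt l_le wXE XE Z0 att.
have [M XM] := km_bounded dot_norm xbar w1 _ _ _ Z _ tau delta sigma eps
  alpha0 delta_gt0 sigma_gt0 tau1 eps0 t_bound t_nondecr l_gt l_le wXE XE Z0 att.
have Xdist := km_dist_cvg dot_norm xbar w1 _ _ _ Z _ tau delta sigma eps
  alpha0 delta_gt0 sigma_gt0 tau1 eps0 t_bound t_nondecr l_gt l_le wXE XE Z0 att.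
have e0 := km_residual_cvg0 dot_norm xbar w1 _ _ _ Z _ tau delta sigma eps
  alpha0 delta_gt0 sigma_gt0 tau1 eps0 t_bound t_nondecr l_gt l_le wXE XE Z0 att.
have wX : (fun n => w1 n - xbar n) @ \oo --> 0.
  apply: norm_cvg0.
  (* [w1 n] is [xbar n] plus [1 + tau_ n.+1 <= 2] times the increment. *)
  apply: (@squeeze_cvgr _ _ _ _ (fun=> 0) (fun n => 2 * `|xbar n.+1 - xbar n|)).
  - apply: nearW => n; rewrite normr_ge0 /= wXE addrAC.
    have /andP[t0 tt] := t_bound n.
    apply: (le_trans (ler_normD _ _)); rewrite normrZ gtr0_norm//.
    have := normr_ge0 (xbar n.+1 - xbar n); nra.
  - exact: cvg_cst.
  - by rewrite -(mulr0 2) -(normr0 H); apply: cvgMr; exact: cvg_norm.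
have [q [u [v [sol Xq xq]]]] := splitting_weak_cvg dot_norm A B Q beta gamma
  beta_gt0 gamma0 gamma4 maxA maxB cocoQ xbar w1 x1 y1 a b w1E a1E Aya Bxb M XM wX e0
  Xdist Z0.
have strong := splitting_strong_cvg dot_norm A B Q beta gamma
  beta_gt0 gamma0 gamma4 maxA maxB cocoQ xbar w1 x1 y1 a b w1E a1E Aya Bxb M XM wX e0
  q u v sol xq.
have [Aq Bq zero_q] := sol.
exists (q + gamma *: v), q; split=> //.
- apply: (@le_lt_trans _ _ C%:E); last exact: ltry.
  apply: lime_le.
    by apply: is_cvg_nneseries => n _ _; rewrite lee_fin sqr_ge0.
  by apply: nearW => n; rewrite sumEFin lee_fin big_add1.
- split.
  + apply/seteqP; split=> p.
      move=> resp; apply: (resolvent_scale_uniq dot_norm B gamma _ _ _ maxB.1 gamma0 resp).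
      by apply/resolvent_scaleP; exists v.
    by move=> ->; apply/resolvent_scaleP; exists v.
  + by move=> z; rewrite -cvg_shiftS; exact: xq.
  + by exists (u + v); [exists u => //; exists v | exists (Q q)].
- by move=> /strong; rewrite -[X in _ -> X]cvg_shiftS.
Qed.
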